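(* Let $v_1,v_2,\dots,v_T$ be a sequence of vectors inserted one at a time (insertions only), possibly chosen by an adaptive adversary. Suppose an offline algorithm $\mathcal{A}$, given any subset of these vectors, produces a signing of that subset with discrepancy (the $\ell_\infty$-norm of the signed sum) at most $D$. Consider the \textsc{Dyadic Resigning} algorithm: when the $t$-th vector arrives, let $2^\ell$ be the largest power of $2$ dividing $t$, and use $\mathcal{A}$ to compute a fresh signing of the $2^\ell$ most recently arrived vectors $v_{t-2^\ell+1},\dots,v_t$ (all other signs unchanged). Then at every time step $2\le t\le T$ the signing of $v_1,\dots,v_t$ has discrepancy at most $D\lceil\log_2 t\rceil$ (and at most $D$ at $t=1$). Moreover, each vector is assigned a new sign at most $\lceil\log_2T\rceil$ times. *)

(* Defs.v *)
From mathcomp Require Import all_boot all_order all_algebra.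
From mathcomp Require Import all_reals.
From mathcomp Require Import matrix_normedtype.

Set Implicit Arguments.
Unset Strict Implicit.
Unset Printing Implicit Defensive.

Import Order.TTheory GRing.Theory Num.Theory.

Local Open Scope ring_scope.

Section Discrepancy.
Context {R : realType} {n : nat}.
Implicit Types (us : seq 'cV[R]_n) (s : seq bool).

(* A sign is encoded by b : bool, standing for (-1) ^+ b. *)
Definition signed_sum us s : 'cV[R]_n :=
  \sum_(p <- zip us s) (-1) ^+ p.2 *: p.1.

(* The norm of matrices is [mx_norm], which is the l_infty norm on 'cV_n. *)
Definition discrepancy us s : R := `|signed_sum us s|.

(* [zip] truncates, hence the size condition: s signs all of us, and only us. *)
Definition signing_within (D : R) us s : Prop :=
  size s = size us /\ discrepancy us s <= D.

End Discrepancy.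

(* The vectors re-signed at time t >= 1 are the v_i, i = 1, 2, ..., with
   kept t < i <= t; the signs of v_1, ..., v_(kept t) are left unchanged. *)
Definition kept (t : nat) : nat := (t - 2 ^ logn 2 t)%N.

Section DyadicResigning.
Context {R : realType} {n : nat}.

(* The t-th entry of a history is v_t together with the signing of v_1, ..., v_t
   held by the algorithm after time t. *)
Definition history := seq ('cV[R]_n * seq bool).

Definition arrived (h : history) : seq 'cV[R]_n := unzip1 h.
Definition current_signing (h : history) : seq bool := last [::] (unzip2 h).

Context {Omega : Type}.
Variable A : Omega -> seq 'cV[R]_n -> seq bool.
Variable omega : nat -> Omega.
Variable adv : history -> 'cV[R]_n.

Definition dyadic_step (h : history) : history :=
  let v := adv h in
  let t := (size h).+1 in
  let k := kept t in
  rcons h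
    (v, take k (current_signing h)
          ++ A (omega t) (drop k (rcons (arrived h) v))).

(* [A w us] is the signing computed by the offline algorithm on us with random
   bits w, and [omega t] are the random bits of its call at time t (take Omega :=
   unit for a deterministic algorithm).  The adversary [adv] picks each vector
   from the entire past history, which does not include future random bits. *)
Definition dyadic_resigning (t : nat) : history := iter t dyadic_step [::].

End DyadicResigning.

Arguments history : clear implicits.

(* The sign which v_i receives on arrival, at time i, is not a new sign; counting
   it, v_1 would be signed log2 T + 1 times when T is a power of 2. *)
Definition new_signs (T i : nat) : nat :=
  count (fun t => (kept t < i)%N) (iota i.+1 (T - i)).

(* Main.v *)
(* At time [t] the first [kept t] signs are those that were in force at time
   [kept t], because dyadic blocks are nested; the remaining block is signed by
   a single call to the offline algorithm.  Hence the discrepancy at time [t] is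
   at most [D] plus that at time [kept t].  Passing from [t] to [kept t] removes
   the lowest binary digit 1 of [t], and these digits lie between positions
   [logn 2 t] and [trunc_log 2 t], which bounds the number of steps.
   For the number of new signs: the resigning of [v_i] at a time [t > i] is
   determined by the exponent [logn 2 t], which lies between 1 and
   [trunc_log 2 T]. *)
Require Import Defs.
From mathcomp Require Import all_boot all_order all_algebra.
From mathcomp Require Import all_reals.
From mathcomp Require Import matrix_normedtype.
From mathcomp Require Import zify.

Set Implicit Arguments.
Unset Strict Implicit.
Unset Printing Implicit Defensive.

Import Order.TTheory GRing.Theory Num.Theory.

(** * Arithmetic of the dyadic blocks *)

Lemma leq_add_dvdn (d a b : nat) : d %| a -> d %| b -> a < b -> a + d <= b.
Proof.
move=> da db ab; rewrite -leq_subRL ?(ltnW ab) //.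
by apply: dvdn_leq; rewrite ?subn_gt0 ?dvdn_sub.
Qed.

Lemma pow_logn_leq (p t : nat) : 0 < t -> p ^ logn p t <= t.
Proof. by move=> t0; apply: dvdn_leq => //; apply: pfactor_dvdnn. Qed.

Lemma keptD (t : nat) : 0 < t -> kept t + 2 ^ logn 2 t = t.
Proof. by move=> t0; rewrite /kept subnK ?pow_logn_leq. Qed.

Lemma kept_lt (t : nat) : 0 < t -> kept t < t.
Proof. by move=> t0; rewrite -[ltnRHS](keptD t0) -addn1 leq_add2l expn_gt0. Qed.

(** Distinct multiples of a power of 2 differ by at least that power. If [s] has the smaller
    exponent, this applies to [kept t] and [s]; otherwise it applies to [s] and [t] and would force
    [s <= kept t], which is excluded. *)
Lemma kept_nested (s t : nat) : kept t < s < t -> kept t <= kept s.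
Proof.
case/andP=> ks st; have s0 : 0 < s by case: s ks {st}.
have t0 : 0 < t := ltn_trans s0 st.
have [jl | lj] := ltnP (logn 2 s) (logn 2 t).
  rewrite -(leq_add2r (2 ^ logn 2 s)) keptD //.
  have dt : 2 ^ logn 2 s %| t by rewrite pfactor_dvdn // ltnW.
  apply: leq_add_dvdn ks; last exact: pfactor_dvdnn.
  by rewrite dvdn_sub // dvdn_exp2l // ltnW.
have ds : 2 ^ logn 2 t %| s by rewrite pfactor_dvdn.
have := leq_add_dvdn ds (pfactor_dvdnn 2 t) st.
by rewrite -[leqRHS](keptD t0) leq_add2r leqNgt ks.
Qed.

(** With t = m * 2 ^ l and m odd, [kept t] is (m - 1) * 2 ^ l, where m - 1 is even. Positivity
    matters because [logn 2 0] is 0. *)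
Lemma logn_kept (t : nat) : 0 < kept t -> logn 2 t < logn 2 (kept t).
Proof.
move=> k0; have t0 : 0 < t by case: t k0.
rewrite -pfactor_dvdn // /kept.
have [m cm] := pfactor_coprime (isT : prime 2) t0.
move: (logn 2 t) => l ->.
rewrite -[X in _ - X]mul1n -mulnBl expnS dvdn_pmul2r ?expn_gt0 //.
have m0 : 0 < m by case: m cm.
by rewrite dvdn2 oddB // -coprime2n cm.
Qed.

Lemma trunc_log_leq_up_log (p t : nat) : 1 < p -> trunc_log p t <= up_log p t.
Proof.
move=> p1; case: t => [|t]; first by rewrite trunc_log0.
rewrite -(leq_exp2l _ _ p1).
exact: leq_trans (trunc_logP p1 (ltn0Sn t)) (up_logP _ p1).
Qed.

(** The two logarithms differ unless [t] is a power of 2. In that case [logn 2 t] equals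
    [trunc_log 2 t], so the left side is 1, and [up_log 2 t] is positive since [1 < t]. *)
Lemma trunc_log_logn_up_log (t : nat) :
  1 < t -> (trunc_log 2 t).+1 - logn 2 t <= up_log 2 t.
Proof.
move=> t1; have [lt_tu | le_ut] := ltnP (trunc_log 2 t) (up_log 2 t).
  exact: leq_trans (leq_subr _ _) lt_tu.
have et : t = 2 ^ trunc_log 2 t.
  apply/eqP; rewrite eqn_leq trunc_logP ?(ltnW t1) // andbT.
  by apply: leq_trans (up_logP t (isT : 1 < 2)) _; rewrite leq_exp2l.
rewrite {2}et pfactorK // subSn // subnn.
by rewrite up_log_gt0.
Qed.

(** * Counting new signs *)

Lemma new_signs_leq_trunc_log (T i : nat) :
  0 < i <= T -> new_signs T i <= trunc_log 2 T.
Proof.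
case/andP=> i0 iT; rewrite /new_signs -size_filter.
set ts := filter _ _.
have in_ts t : t \in ts -> [/\ kept t < i, i < t & t <= T].
  by rewrite mem_filter mem_iota => /and3P[ki it tT]; split=> //; lia.
rewrite -(size_map (logn 2)) -[leqRHS](size_iota 1).
apply: uniq_leq_size.
  rewrite map_inj_in_uniq ?filter_uniq ?iota_uniq //.
  suff le t t' : t \in ts -> t' \in ts -> logn 2 t = logn 2 t' -> t <= t'.
    by move=> t t' ht ht' e; apply/eqP; rewrite eqn_leq !le.
  (* If [t' < t] had the same exponent, then [t'] would be at most [kept t], giving
     [i < t' <= kept t < i]. *)
  move=> /in_ts[ki it _] /in_ts[_ it' _] e; rewrite leqNgt; apply/negP => tt.
  have d' : 2 ^ logn 2 t %| t' by rewrite e pfactor_dvdnn.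
  have := leq_add_dvdn d' (pfactor_dvdnn 2 t) tt.
  have := keptD (leq_ltn_trans (leq0n i) it); lia.
move=> _ /mapP[t /in_ts[ki it tT] ->].
have t0 : 0 < t := leq_ltn_trans (leq0n i) it.
rewrite mem_iota add1n ltnS; apply/andP; split.
  (* With exponent 0 only the vector arriving at time [t] is signed, whereas [i < t]. *)
  rewrite lt0n; apply/negP => /eqP l0.
  by move: (keptD t0); rewrite l0 expn0; lia.
by apply: trunc_log_max => //; apply: leq_trans (pow_logn_leq _ t0) tT.
Qed.

Local Open Scope ring_scope.

(** * Concatenation of signings *)

Section Discrepancy.
Context {R : realType} {n : nat}.
Implicit Types (us : seq 'cV[R]_n) (s : seq bool).

Lemma signed_sum_cat us1 us2 s1 s2 : size s1 = size us1 ->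
  signed_sum (us1 ++ us2) (s1 ++ s2) = signed_sum us1 s1 + signed_sum us2 s2.
Proof. by move=> e; rewrite /signed_sum zip_cat // big_cat. Qed.

Lemma signing_within_nil : signing_within 0 ([::] : seq 'cV[R]_n) [::].
Proof. by split=> //; rewrite /discrepancy /signed_sum big_nil normr0. Qed.

Lemma signing_within_cat (D1 D2 : R) us1 us2 s1 s2 :
  signing_within D1 us1 s1 -> signing_within D2 us2 s2 ->
  signing_within (D1 + D2) (us1 ++ us2) (s1 ++ s2).
Proof.
move=> [e1 d1] [e2 d2]; split; first by rewrite !size_cat e1 e2.
rewrite /discrepancy signed_sum_cat //.
exact: le_trans (ler_normD _ _) (lerD d1 d2).
Qed.

Lemma signing_within_le (D1 D2 : R) us s :
  D1 <= D2 -> signing_within D1 us s -> signing_within D2 us s.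
Proof. by move=> le12 [e d]; split=> //; apply: le_trans le12. Qed.

End Discrepancy.

(** * Histories of the algorithm and their discrepancy *)

Section DyadicResigning.
Context {R : realType} {n : nat} {Omega : Type}.
Variables (A : Omega -> seq 'cV[R]_n -> seq bool) (omega : nat -> Omega).
Variable adv : history R n -> 'cV[R]_n.
Let H := dyadic_resigning A omega adv.

Lemma size_history t : size (H t) = t.
Proof. by elim: t => //= t IH; rewrite size_rcons IH. Qed.

Lemma size_arrived t : size (arrived (H t)) = t.
Proof. by rewrite size_map size_history. Qed.

Lemma arrivedS t : arrived (H t.+1) = rcons (arrived (H t)) (adv (H t)).
Proof. exact: map_rcons. Qed.

Lemma take_arrived s t : (s <= t)%N -> take s (arrived (H t)) = arrived (H s).
Proof.
elim: t => [|t IH]; first by rewrite leqn0 => /eqP ->.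
rewrite leq_eqVlt => /predU1P[-> | st].
  by rewrite take_oversize // size_arrived.
by rewrite arrivedS -cats1 takel_cat ?IH // size_arrived.
Qed.

Lemma current_signingS t : let k := kept t.+1 in
  current_signing (H t.+1) =
  take k (current_signing (H t)) ++ A (omega t.+1) (drop k (arrived (H t.+1))).
Proof.
rewrite /= arrivedS {1}/current_signing.
rewrite [unzip2 _](map_rcons _ (H t)) last_rcons /=.
by rewrite size_history.
Qed.

Context {T : nat} {D : R}.
Hypothesis offline : forall (w : Omega) (us : seq 'cV[R]_n),
  subseq us (arrived (H T)) -> signing_within D us (A w us).

Lemma offline_ge0 (w : Omega) : 0 <= D.
Proof.
by have [_] := offline w (sub0seq _); apply: le_trans; apply: normr_ge0.
Qed.

(** A block is a suffix of a prefix of the final sequence, hence one of the subsequences covered by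
    [offline]. *)
Lemma block_signing_within w k t : (t <= T)%N ->
  signing_within D (drop k (arrived (H t))) (A w (drop k (arrived (H t)))).
Proof.
move=> tT; apply: offline; apply: subseq_trans (drop_subseq _ _) _.
by rewrite -(take_arrived tT) take_subseq.
Qed.

Lemma size_current_signing t : (t <= T)%N -> size (current_signing (H t)) = t.
Proof.
elim: t => // t IH tT.
have [e _] := block_signing_within (omega t.+1) (kept t.+1) tT.
have kt : (kept t.+1 <= t)%N by rewrite -ltnS kept_lt.
rewrite current_signingS size_cat e size_drop size_arrived size_take_min.
by rewrite IH ?(ltnW tT) // (minn_idPl kt) subnKC // ltnW.
Qed.

(** A call at time [s] rewrites only signs past position [kept s], so the first [k] survive every
    call with [k <= kept s]. *)
Lemma take_current_signing k t : (k <= t <= T)%N ->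
  (forall s, (k < s <= t)%N -> (k <= kept s)%N) ->
  take k (current_signing (H t)) = current_signing (H k).
Proof.
elim: t => [|t IH]; first by rewrite leqn0 => /andP[/eqP ->].
rewrite leq_eqVlt => /andP[/predU1P[-> | kt] tT] nested.
  by rewrite take_oversize // size_current_signing.
have kk : (k <= kept t.+1)%N by rewrite nested // kt leqnn.
have kt1 : (kept t.+1 <= t)%N by rewrite -ltnS kept_lt.
rewrite current_signingS takel_cat; last first.
  by rewrite size_take_min size_current_signing ?(ltnW tT) // (minn_idPl kt1).
rewrite take_takel //; apply: IH => [|s /andP[ks st]].
  by rewrite -ltnS kt ltnW.
by apply: nested; rewrite ks leqW.
Qed.

Lemma signing_within_kept (D' : R) t : (0 < t <= T)%N ->
  signing_within D' (arrived (H (kept t))) (current_signing (H (kept t))) ->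
  signing_within (D' + D) (arrived (H t)) (current_signing (H t)).
Proof.
case: t => // t /andP[_ tT] IH.
have kt : (kept t.+1 <= t)%N by rewrite -ltnS kept_lt.
(* No call strictly between the times [kept t.+1] and [t.+1] reaches below [kept t.+1]. *)
have nested s : (kept t.+1 < s <= t)%N -> (kept t.+1 <= kept s)%N.
  by rewrite -[(s <= t)%N]ltnS; apply: kept_nested.
have kT : (kept t.+1 <= t <= T)%N by rewrite kt ltnW.
rewrite current_signingS (take_current_signing kT nested).
rewrite -{1}(cat_take_drop (kept t.+1) (arrived (H t.+1))).
rewrite take_arrived ?leqW //.
exact: signing_within_cat IH (block_signing_within _ _ tT).
Qed.

(** The factor counts the binary positions from the lowest to the highest digit 1 of [t]. When
    [kept t] is positive, it is smaller there by at least 1, which pays for the extra [D]. *)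
Lemma dyadic_signing_within t : (0 < t <= T)%N ->
  signing_within (D * ((trunc_log 2 t).+1 - logn 2 t)%:R)
    (arrived (H t)) (current_signing (H t)).
Proof.
have D0 := offline_ge0 (omega 0).
elim/ltn_ind: t => t IH tT; have /andP[t0 leT] := tT.
have lt : (logn 2 t <= trunc_log 2 t)%N.
  by apply: trunc_log_max => //; apply: pow_logn_leq.
have [k0 | k0] := posnP (kept t).
  (* Here [t] is a power of 2: a single call signs all vectors, and the factor is at least 1. *)
  have := signing_within_kept (D' := 0) tT.
  rewrite k0 add0r => /(_ signing_within_nil); apply: signing_within_le.
  by rewrite ler_peMr // ler1n subn_gt0 ltnS.
have kt := kept_lt t0.
have := signing_within_kept tT (IH _ kt _); rewrite k0 (leq_trans (ltnW kt)) //.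
move=> /(_ isT); apply: signing_within_le.
rewrite -{2}[D]mulr1 -mulrDr ler_wpM2l // natr1 ler_nat.
have := logn_kept k0; have := leq_trunc_log 2 (ltnW kt); lia.
Qed.

End DyadicResigning.

Theorem theorem6p1 (R : realType) (n T : nat) (D : R) (Omega : Type)
    (A : Omega -> seq 'cV[R]_n -> seq bool) (omega : nat -> Omega)
    (adv : history R n -> 'cV[R]_n) :
  let H := dyadic_resigning A omega adv in
  (forall (w : Omega) (us : seq 'cV[R]_n),
     subseq us (arrived (H T)) -> signing_within D us (A w us)) ->
  [/\ (1 <= T)%N ->
        signing_within D (arrived (H 1%N)) (current_signing (H 1%N)),
      forall t : nat, (2 <= t <= T)%N ->
        signing_within (D * (up_log 2 t)%:R)
          (arrived (H t)) (current_signing (H t))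
    & forall i : nat, (1 <= i <= T)%N -> (new_signs T i <= up_log 2 T)%N].
Proof.
move=> H offline; split=> [T1 | t /andP[t1 tT] | i iT].
- have := dyadic_signing_within offline (t := 1%N) T1.
  (* At time 1 the factor is 1 while [up_log 2 1] is 0, hence the separate clause. *)
  by rewrite trunc_log1 logn1 mulr1.
- have := dyadic_signing_within offline (t := t).
  rewrite (ltnW t1) tT => /(_ isT); apply: signing_within_le.
  rewrite ler_wpM2l ?(offline_ge0 offline (omega 0%N)) // ler_nat.
  exact: trunc_log_logn_up_log.
apply: leq_trans (new_signs_leq_trunc_log iT) _.
exact: trunc_log_leq_up_log.
Qed.
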